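(* For positive integers $n,k$ with $1\leq k\leq n$, $$E(2n,k)=\sum_{\substack{\alpha_1+\cdots+\alpha_k=n\\ \alpha_i\geq 1}}\zeta(2\alpha_1,2\alpha_2,\ldots,2\alpha_k)=\frac{(-1)^{n-k}\pi^{2n}}{(2n+1)!}\sum_{q=0}^{n-k}\binom{n-q}{k}\binom{2n+1}{2q}2^{2q}B_{2q}\!\left(\tfrac12\right).$$
   Context: For positive integers $\alpha_1,\ldots,\alpha_r$ with $\alpha_r\geq 2$, $\zeta(\alpha_1,\ldots,\alpha_r)=\sum_{1\leq k_1<\cdots<k_r}k_1^{-\alpha_1}\cdots k_r^{-\alpha_r}$ (multiple zeta value). The Bernoulli polynomials $B_n(x)$ are defined by $\frac{te^{xt}}{e^t-1}=\sum_{n\geq 0}B_n(x)\frac{t^n}{n!}$. *)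

(* Defs.v *)
From HB Require Import structures.
From mathcomp Require Import all_boot all_order all_algebra.
From mathcomp Require Import all_classical all_reals all_analysis.
From mathcomp Require Import ring lra.

Set Implicit Arguments.
Unset Strict Implicit.
Unset Printing Implicit Defensive.
Import Order.TTheory GRing.Theory Num.Theory.
Import numFieldNormedType.Exports.
Local Open Scope classical_set_scope.
Local Open Scope ring_scope.

(* The sum of nonnegative terms over all tuples 0 < m_1 < ... < m_r; it takes
   the value +oo when it diverges, so no condition on the last exponent is
   built in. *)
Definition mzv (R : realType) (r : nat) (alpha : 'I_r -> nat) : \bar R :=
  \esum_(m in [set m : {ffun 'I_r -> nat} |
                (forall i, (0 < m i)%N) /\ {homo m : i j / (i < j)%N}])
    (\prod_(i < r) (m i)%:R ^- alpha i)%:E.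

(* E(2n, k). A part of a composition of n is at most n, so the parts can be
   taken in 'I_n.+1. *)
Definition even_mzv_sum (R : realType) (n k : nat) : \bar R :=
  (\sum_(alpha : {ffun 'I_k -> 'I_n.+1} |
          [forall i, (0 < alpha i)%N] && (\sum_(i < k) alpha i == n)%N)
     mzv R (fun i => (2 * alpha i)%N))%E.

(* The point t = 0 is excluded, as t e^(xt) / (e^t - 1) is undefined there. *)
Definition bernoulli_generating (R : realType) (B : nat -> {poly R}) : Prop :=
  forall x : R, \forall t \near 0^',
    series (fun n => (B n).[x] * t ^+ n / n`!%:R) @ \oo -->
      t * expR (x * t) / (expR t - 1).

Section cauchy_product.
Variable R : realType.
Implicit Types a b : R^nat.

Let conv a b : R^nat := fun n => \sum_(i < n.+1) a i * b (n - i)%N.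

Let series_conv a b N :
  series (conv a b) N = \sum_(i < N) a i * series b (N - i)%N.
Proof.
elim: N => [|N IH]; first by rewrite /series /= big_geq// big_ord0.
rewrite seriesSr IH [in RHS]big_ord_recr /= subSnn /conv big_ord_recr /= subnn.
rewrite addrA -big_split /=; congr (_ + _); last first.
  by rewrite /series /= big_nat1.
apply: eq_bigr => i _; rewrite -mulrDr; congr (_ * _).
by rewrite subSn ?(ltnW (ltn_ord i))// seriesSr.
Qed.

Let nser_nd b : nondecreasing_seq [normed series b].
Proof. by apply: nondecreasing_series => n _ _; rewrite normr_ge0. Qed.

Let nconv_cvg a b : cvgn [normed series a] -> cvgn [normed series b] ->
  (fun N => [normed series a] N * [normed series b] N -
    series (conv (fun n => `|a n|) (fun n => `|b n|)) N) @ \oo --> (0 : R).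
Proof.
move=> ca cb; set A := [normed series a]; set B := [normed series b].
set D := series _.
have B0 n : 0 <= B n by rewrite /B /series /=; apply: sumr_ge0.
have AE N : A N = \sum_(i < N) `|a i| by rewrite /A /= seriesEord.
have DAB N : D N <= A N * B N.
  rewrite /D series_conv AE mulr_suml ler_sum// => i _.
  by rewrite ler_wpM2l//; apply: nser_nd; rewrite leq_subr.
have ABD N : A N * B N <= D (2 * N)%N.
  rewrite /D series_conv AE mulr_suml.
  rewrite -(big_mkord xpredT (fun i => `|a i| * B N)).
  rewrite -(big_mkord xpredT
    (fun i => `|a i| * series (fun n => `|b n|) (2 * N - i)%N)).
  have NN : (N <= 2 * N)%N by rewrite leq_pmull.
  rewrite [leRHS](@big_cat_nat _ _ _ N)//= -[leLHS]addr0 lerD//.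
    rewrite [leLHS]big_nat [leRHS]big_nat; apply: ler_sum => i /= iN.
    rewrite ler_wpM2l//; apply: nser_nd.
    by rewrite mul2n -addnn -addnBA ?leq_addr// ltnW.
  by apply: sumr_ge0 => i _; rewrite mulr_ge0//; exact: B0.
have Dnd : nondecreasing_seq D.
  apply: nondecreasing_series => n _ _.
  by apply: sumr_ge0 => i _; rewrite mulr_ge0.
have cAB : (A \* B) @ \oo --> limn A * limn B by exact: cvgM.
have AA n : A n <= limn A by apply: nondecreasing_cvgn_le; [exact: nser_nd|].
have BB n : B n <= limn B by apply: nondecreasing_cvgn_le; [exact: nser_nd|].
have A0 n : 0 <= A n by rewrite /A /series /=; apply: sumr_ge0.
have cD : cvgn D.
  apply: nondecreasing_is_cvgn; first exact: Dnd.
  exists (limn A * limn B) => _ [n _ <-].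
  by apply: (le_trans (DAB n)); rewrite ler_pM.
have cD2 : (fun N => D (2 * N)%N) @ \oo --> limn D.
  apply: (@cvg_comp _ _ _ (fun N => (2 * N)%N) D _ _ _ _ cD).
  apply/cvgnyPge => M; exists M => // m /= Mm.
  by rewrite (leq_trans Mm)// leq_pmull.
have cAB' : (A \* B) @ \oo --> limn D.
  apply: (squeeze_cvgr _ cD cD2).
  by apply: nearW => N; rewrite DAB ABD.
have H : (A \* B - D) @ \oo --> limn D - limn D by exact: cvgB.
by rewrite subrr in H; exact: H.
Qed.

Lemma cauchy_product a b :
    cvgn [normed series a] -> cvgn [normed series b] ->
  series (fun n => \sum_(i < n.+1) a i * b (n - i)%N) @ \oo -->
    limn (series a) * limn (series b).
Proof.
move=> ca cb.
have cab : (series a \* series b) @ \oo --> limn (series a) * limn (series b).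
  by apply: cvgM; exact: normed_cvg.
have := nconv_cvg ca cb.
set d := (X in X @ _ --> _) => d0.
have e0 : (series a \* series b - series (conv a b)) @ \oo --> (0 : R).
  have nd0 : (fun n => - d n) @ \oo --> (0 : R) by rewrite -oppr0; exact: cvgN.
  apply: (squeeze_cvgr _ nd0 d0); apply: nearW => N.
  rewrite -ler_norml /d !fctE !series_conv.
  rewrite {1}/series [X in X * _ - _]big_mkord /= mulr_suml -sumrB.
  rewrite [X in _ <= X * _ - _]/series /= big_mkord mulr_suml -sumrB.
  apply: (le_trans (ler_norm_sum _ _ _)); apply: ler_sum => i _.
  rewrite -!mulrBr normrM ler_wpM2l//.
  rewrite !sub_series leq_subr.
  exact: ler_norm_sum.
have -> : series (fun n => \sum_(i < n.+1) a i * b (n - i)%N) =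
    series a \* series b - (series a \* series b - series (conv a b)).
  by rewrite opprB addrC subrK.
rewrite -[X in _ --> X]subr0; exact: cvgB.
Qed.

End cauchy_product.

Section bernoulli_exists.
Variable R : realType.

Let c (n : nat) : R := (n.+1)`!%:R^-1.

Let bs := fix bs n : seq R := if n is n'.+1 then
  rcons (bs n') (- \sum_(i < n) (bs n')`_i * c (n - i)) else [:: 1].

Let size_bs n : size (bs n) = n.+1.
Proof. by elim: n => //= n IH; rewrite size_rcons IH. Qed.

Let b n := (bs n)`_n.

Let nth_bs n i : (i <= n)%N -> (bs n)`_i = b i.
Proof.
elim: n => [|n IH]; first by rewrite leqn0 => /eqP ->.
rewrite leq_eqVlt => /predU1P[->//|iN] /=.
by rewrite nth_rcons size_bs iN IH.
Qed.

Let bS n : b n.+1 = - \sum_(i < n.+1) b i * c (n.+1 - i).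
Proof.
rewrite {1}/b /= nth_rcons size_bs ltnn eqxx; congr (- _).
by apply: eq_bigr => i _; rewrite nth_bs// -ltnS.
Qed.

Let b_conv n : \sum_(i < n.+1) b i * c (n - i) = (n == 0)%:R.
Proof.
case: n => [|n]; first by rewrite big_ord1 /b /c /= mul1r invr1.
by rewrite big_ord_recr /= subnn bS {3}/c invr1 mulr1 subrr.
Qed.

Let c_le n : c n <= 2^-1 ^+ n.
Proof.
rewrite exprVn lef_pV2 ?posrE ?exprn_gt0 ?ltr0n ?fact_gt0//.
rewrite -natrX ler_nat; elim: n => // n IH.
by rewrite factS expnS leq_mul.
Qed.

Let half_sum n : \sum_(i < n) 2^-1 ^+ (n - i) <= 1 :> R.
Proof.
suff -> : \sum_(i < n) 2^-1 ^+ (n - i) = 1 - 2^-1 ^+ n :> R.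
  by rewrite gerBl exprn_ge0// invr_ge0.
elim: n => [|n IH]; first by rewrite big_ord0 expr0 subrr.
rewrite big_ord_recl subn0.
under eq_bigr do rewrite lift0 subSS.
rewrite IH exprS; lra.
Qed.

Let b_le n : `|b n| <= 1.
Proof.
elim/ltn_ind: n => -[|n] IH; first by rewrite /b /= normr1.
rewrite bS normrN (le_trans (ler_norm_sum _ _ _))//.
apply: le_trans (half_sum n.+1); apply: ler_sum => i _.
rewrite normrM -[leRHS]mul1r ler_pM ?IH//.
by rewrite ger0_norm ?c_le// invr_ge0.
Qed.

Lemma bernoulli_exists : exists B : nat -> {poly R}, bernoulli_generating B.
Proof.
exists (fun n => \sum_(i < n.+1) (n`!%:R * b i / (n - i)`!%:R) *: 'X^(n - i)).
move=> x; near=> t.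
have t0 : t != 0 by near: t; exact: nbhs_dnbhs_neq.
have t1 : `|t| < 1.
  near: t; apply: dnbhs0_lt; exact: ltr01.
have geo : cvgn (series (fun n => `|t| ^+ n)).
  suff -> : (fun n => `|t| ^+ n) = geometric 1 `|t|.
    by apply: is_cvg_geometric_series; rewrite normr_id.
  by apply/funext => n; rewrite /= mul1r.
have cvb : cvgn [normed series (fun n => b n * t ^+ n)].
  apply: (series_le_cvg _ _ _ geo) => n /=; [exact: normr_ge0|exact: exprn_ge0|].
  by rewrite normrM normrX -[leRHS]mul1r ler_wpM2r// exprn_ge0.
have cvc : cvgn [normed series (fun n => c n * t ^+ n)].
  apply: (series_le_cvg _ _ _ geo) => n /=; [exact: normr_ge0|exact: exprn_ge0|].
  rewrite normrM normrX -[leRHS]mul1r ler_wpM2r ?exprn_ge0//.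
  rewrite ger0_norm ?invr_ge0// (le_trans (c_le n))//.
  by rewrite exprn_ile1 ?invr_ge0// invf_le1// ler1n.
have cve y : cvgn [normed series (exp_coeff y : R^nat)].
  by rewrite normed_series_exp_coeff; exact: is_cvg_series_exp_coeff.
set beta : R := limn (series (fun n => b n * t ^+ n)).
have limc : limn (series (fun n => c n * t ^+ n)) * t = expR t - 1.
  apply/eqP; rewrite eq_sym subr_eq; apply/eqP.
  apply: cvg_lim => //; rewrite -(cvg_shiftS _).
  have -> : (fun n => series (exp_coeff t) n.+1) =
      (fun n => series (fun n => c n * t ^+ n) n * t + 1).
    apply/funext => n; rewrite /series /= big_nat_recl// addrC.
    rewrite /exp_coeff /= expr0 invr1 mulr1; congr (_ + _).
    rewrite mulr_suml; apply: eq_bigr => i _.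
    by rewrite exprSr mulrC mulrA.
  by apply: cvgD; [apply: cvgMr_tmp; exact: normed_cvg|exact: cvg_cst].
have betaE : beta * (expR t - 1) = t.
  rewrite -limc mulrA.
  suff -> : beta * limn (series (fun n => c n * t ^+ n)) = 1 by rewrite mul1r.
  have /cvg_lim <-// := cauchy_product cvb cvc; apply: cvg_lim => //.
  rewrite -(cvg_shiftS _) (_ : (fun n => _) = cst 1); first exact: cvg_cst.
  apply/funext => n; rewrite /series /= big_nat_recl//= big_ord1.
  rewrite subnn {1}/b /c /= !expr0 invr1 !mulr1 big1 ?addr0// => i _.
  transitivity (t ^+ i.+1 * \sum_(j < i.+2) b j * c (i.+1 - j)).
    rewrite mulr_sumr; apply: eq_bigr => j _.
    have ji : (j <= i.+1)%N by rewrite -ltnS.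
    have -> : t ^+ i.+1 = t ^+ j * t ^+ (i.+1 - j) by rewrite -exprD subnKC.
    by rewrite mulrACA mulrC.
  by rewrite b_conv mulr0.
have et : expR t - 1 != 0.
  by apply: contra t0 => /eqP e0; rewrite -betaE e0 mulr0.
have -> : t * expR (x * t) / (expR t - 1) = beta * expR (x * t).
  by rewrite -{1}betaE mulrAC mulrAC [X in X / _]mulrAC mulfK// mulrC.
have H := cauchy_product cvb (cve (x * t)).
set f := (X in series X); suff -> : f = (fun n => \sum_(i < n.+1)
    b i * t ^+ i * exp_coeff (x * t) (n - i)%N) by exact: H.
apply/funext => n; rewrite /f /exp_coeff /= horner_sum !mulr_suml.
apply: eq_bigr => i _; rewrite hornerZ hornerXn.
have ni : (i <= n)%N by rewrite -ltnS.
have nf : n`!%:R != 0 :> R by rewrite pnatr_eq0 -lt0n fact_gt0.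
have -> : t ^+ n = t ^+ i * t ^+ (n - i) by rewrite -exprD subnKC.
have df : (n - i)`!%:R != 0 :> R by rewrite pnatr_eq0 -lt0n fact_gt0.
rewrite exprMn; set p := x ^+ _; set q := t ^+ i; set s := t ^+ (n - i).
by field; rewrite nf df.
Unshelve. all: by end_near. Qed.

End bernoulli_exists.

(* bernoulli_generating determines the sequence uniquely, by comparison of power
   series coefficients, so the result does not depend on the choice made. *)
Definition bernoulli_poly (R : realType) : nat -> {poly R} :=
  sval (cid (bernoulli_exists R)).

Lemma bernoulli_polyP (R : realType) : bernoulli_generating (@bernoulli_poly R).
Proof. exact: svalP. Qed.

(* Main.v *)
(* Put x_j = 1/j^2 and truncate all sums at j <= N. The truncation of E(2n,k) is
   the coefficient of t^n s^k in the product over j <= N of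
     1 + s (x_j t + x_j^2 t^2 + ...) = (1 - (1 - s) x_j t) / (1 - x_j t),
   so convolving it with the signed elementary symmetric functions
   (-1)^i e_i(x_1, ..., x_N) gives (-1)^(n+k) C(n,k) e_n(x_1, ..., x_N).
   As N grows, e_i tends to pi^(2i)/(2i+1)!; this follows by squeezing x_j
   between multiples of 1/tan^2(j pi/(2N+1)) and of 1/sin^2(j pi/(2N+1)), because
   the tan^2(j pi/(2N+1)) are the roots of the polynomial expressing
   sin((2N+1)x)/(cos^(2N+1) x tan x) in tan^2 x. Hence the truncations converge, by
   induction on n. The limiting convolution equation is solved with the inverse of
   sin(pi t)/(pi t), whose coefficients are, up to sign and geom_poly of pi, the
   2^(2q) B_2q(1/2)/(2q)!, since the numbers 2^m B_m(1/2)/m! are the Taylor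
   coefficients of t/sinh t. *)
Require Import Defs.
From mathcomp Require Import all_boot all_order all_algebra.
From mathcomp Require Import all_classical all_reals all_analysis.
From mathcomp Require Import ring.
Import Order.TTheory GRing.Theory Num.Theory.
Import numFieldNormedType.Exports.
Local Open Scope ring_scope.

Set Implicit Arguments.
Unset Strict Implicit.
Unset Printing Implicit Defensive.

(** * Elementary symmetric functions over a commutative ring *)

Definition increasing (k N : nat) (m : {ffun 'I_k -> 'I_N}) : bool :=
  [forall i : 'I_k, forall j : 'I_k, (i < j)%N ==> (m i < m j)%N].

Lemma increasingP (k N : nat) (m : {ffun 'I_k -> 'I_N}) :
  reflect {homo m : i j / (i < j)%N} (increasing m).
Proof.
by apply: (iffP 'forall_'forall_implyP) => mi i j; exact: mi.
Qed.

Section elementary_symmetric.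
Variable A : comNzRingType.
Implicit Type x : nat -> A.

(** Taken as a coefficient of a product so that the recursion in [N] is immediate. The ring is
    arbitrary because the function is applied both to reals and to the polynomials [geom_poly]. *)
Definition esymf x (N k : nat) : A := (\prod_(j < N) (1 + x j *: 'X))`_k.

Lemma esymf0n x k : esymf x 0 k = (k == 0)%:R.
Proof. by rewrite /esymf big_ord0 coef1. Qed.

Lemma esymfS0 x N : esymf x N.+1 0 = esymf x N 0.
Proof.
by rewrite /esymf big_ord_recr/= mulrDr mulr1 -scalerAr coefD coefZ coefMX/= mulr0 addr0.
Qed.

Lemma esymfSS x N k : esymf x N.+1 k.+1 = esymf x N k.+1 + x N * esymf x N k.
Proof. by rewrite /esymf big_ord_recr/= mulrDr mulr1 -scalerAr coefD coefZ coefMX. Qed.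

Lemma esymfn0 x N : esymf x N 0 = 1.
Proof. by elim: N => [|N IH]; rewrite ?esymf0n// esymfS0. Qed.

Lemma esymfZ (c : A) x N k : esymf (fun j => c * x j) N k = c ^+ k * esymf x N k.
Proof.
elim: N k => [|N IH] [|k]; rewrite ?esymfn0 ?mul1r ?esymf0n ?mulr0//.
by rewrite !esymfSS !IH mulrDr exprS; congr (_ + _); rewrite mulrACA.
Qed.

(** Distributivity turns the product into a sum over the [k]-element subsets of ['I_N], and each
    such subset is the image of exactly one increasing map. *)
Lemma esymf_sum x N k :
  esymf x N k = \sum_(m : {ffun 'I_k -> 'I_N} | increasing m) \prod_i x (m i).
Proof.
pose h (m : {ffun 'I_k -> 'I_N}) := [set m i | i : 'I_k].
have minj (m : {ffun 'I_k -> 'I_N}) : increasing m -> injective m.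
  move=> /increasingP mi i j mij; apply/val_inj; case: (ltngtP i j) => // /mi;
  by rewrite mij ltnn.
have hinj : {in [set m | increasing m] &, injective h}.
  move=> m m'; rewrite !inE => /increasingP mi /increasingP mi' hmm'.
  (* Two strictly sorted lists with the same elements coincide. *)
  suff mm' : map m (enum 'I_k) = map m' (enum 'I_k).
    by apply/ffunP => i; move/eq_in_map: mm'; apply; rewrite mem_enum.
  have srt (f : {ffun 'I_k -> 'I_N}) : {homo f : i j / (i < j)%N} ->
      sorted (relpre val ltn) (map f (enum 'I_k)).
    move=> fi; apply: (@homo_sorted _ _ _ (relpre val ltn)); first by move=> i j; exact: fi.
    by rewrite -sorted_map val_enum_ord iota_ltn_sorted.
  apply: (@irr_sorted_eq _ (relpre val ltn)); first by move=> a b c; exact: ltn_trans.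
  - by move=> a /=; rewrite ltnn.
  - exact: srt.
  - exact: srt.
  move=> a; have := congr1 (fun J : {set _} => a \in J) hmm'.
  rewrite /h => E; apply/mapP/mapP => -[i _ ai].
  - have : a \in [set m i | i : 'I_k] by apply/imsetP; exists i.
    by rewrite E => /imsetP[j _ ->]; exists j => //; rewrite mem_enum.
  - have : a \in [set m' i | i : 'I_k] by apply/imsetP; exists i.
    by rewrite -E => /imsetP[j _ ->]; exists j => //; rewrite mem_enum.
have himg : h @: [set m | increasing m] = [set J : {set 'I_N} | #|J| == k].
  apply/setP => J; rewrite [RHS]inE; apply/imsetP/eqP => [[m]|].
    by rewrite inE => mi ->; rewrite /h card_imset ?card_ord//; exact: minj.
  move=> Jk; rewrite /h -Jk {minj hinj}.
  (* The preimage of [J] lists its elements in increasing order. *)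
  exists [ffun i => enum_val i]; last first.
    apply/setP => a; apply/idP/imsetP => [aJ|[i _ ->]]; last by rewrite ffunE enum_valP.
    by exists (enum_rank_in aJ a) => //; rewrite ffunE enum_rankK_in.
  rewrite inE; apply/increasingP => i j ij; rewrite !ffunE.
  have x0 : 'I_N by exact: (enum_val i).
  rewrite !(enum_val_nth x0).
  apply: (@sorted_ltn_nth _ (relpre val ltn)) => //.
  - by move=> a b c; exact: ltn_trans.
  - rewrite /enum_mem; apply: sorted_filter; first by move=> a b c; exact: ltn_trans.
    by rewrite -sorted_map -enumT val_enum_ord iota_ltn_sorted.
  - by rewrite inE -cardE.
  - by rewrite inE -cardE.
rewrite /esymf; under eq_bigr do rewrite addrC.
rewrite bigA_distr/= coef_sum.
transitivity (\sum_(J in [set J : {set 'I_N} | #|J| == k]) \prod_(j in J) x j).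
  rewrite (bigID (fun J : {set 'I_N} => #|J| == k))/= [X in _ + X]big1 ?addr0.
    apply: eq_big => J; first by rewrite !inE.
    move=> /eqP Jk.
    by rewrite -big_mkcond/= scaler_prod prodr_const Jk coefZ coefXn eqxx mulr1.
  move=> J Jk; rewrite -big_mkcond/= scaler_prod prodr_const coefZ coefXn.
  by rewrite eq_sym (negbTE Jk) mulr0.
rewrite -himg big_imset//=; apply: eq_big => m; first by rewrite inE.
rewrite inE => mi; rewrite /h big_imset//= => i j _ _; exact: minj.
Qed.

End elementary_symmetric.

Local Open Scope classical_set_scope.
Local Open Scope ring_scope.

(** * Multiple-angle formulas and squared cotangents *)

Section sine_polynomials.
Variable R : realType.
Implicit Types (n N k : nat) (x t : R).

(** Such a polynomial is its constant term times the product of the [1 - X / z j]; the roots are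
    nonzero because the constant term is. *)
Lemma coef_esymf_roots (p : {poly R}) (z : nat -> R) N k :
    (size p <= N.+1)%N -> p`_0 != 0 ->
    (forall j, (j < N)%N -> root p (z j)) ->
    {in [pred j | (j < N)%N] &, injective z} ->
  p`_k = p`_0 * esymf (fun j => - (z j)^-1) N k.
Proof.
move=> sp p0 rz zi; set rs := mkseq z N.
have pn0 : p != 0 by apply: contraNneq p0 => ->; rewrite coef0.
have urs : uniq rs.
  by rewrite map_inj_in_uniq ?iota_uniq// => i j; rewrite !mem_iota !add0n; exact: zi.
have ars : all (root p) rs.
  by apply/allP => _ /mapP[j + ->]; rewrite mem_iota add0n => jN; exact: rz.
have sp' : size p = (size rs).+1.
  by apply/eqP; rewrite eqn_leq size_mkseq sp/= -{1}(size_mkseq z N) max_poly_roots.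
have := all_roots_prod_XsubC sp' ars; rewrite uniq_rootsE => /(_ urs).
rewrite /rs /mkseq big_map -[X in iota 0 X]subn0 big_mkord.
have zn0 (j : 'I_N) : z j != 0.
  apply: contraNneq p0 => zj; have := rz j (ltn_ord j).
  by rewrite zj /root horner_coef0.
rewrite (eq_bigr (fun j : 'I_N => (- z j) *: (1 + (- (z j)^-1) *: 'X))); last first.
  by move=> j _; rewrite scalerDr scalerA mulrNN mulfV// scale1r scaleNr addrC alg_polyC.
rewrite scaler_prod scalerA; set c := _ * _ => pE.
rewrite pE !coefZ -/(esymf (fun j => - (z j)^-1) N k).
by rewrite -/(esymf (fun j => - (z j)^-1) N 0) esymfn0 mulr1.
Qed.

(** De Moivre: (1 + i t)^n = C(t^2) + i t S(t^2), where C is this polynomial and S is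
    [sin_poly n]. *)
Definition cos_poly n : {poly R} := \poly_(i < n.+1) ((-1) ^+ i * 'C(n, i.*2)%:R).
Definition sin_poly n : {poly R} := \poly_(i < n.+1) ((-1) ^+ i * 'C(n, i.*2.+1)%:R).

Lemma coef_cos_poly n i : (cos_poly n)`_i = (-1) ^+ i * 'C(n, i.*2)%:R.
Proof.
rewrite coef_poly; case: ltnP => // ni; rewrite bin_small ?mulr0//.
by rewrite -addnn (leq_trans ni)// leq_addr.
Qed.

Lemma coef_sin_poly n i : (sin_poly n)`_i = (-1) ^+ i * 'C(n, i.*2.+1)%:R.
Proof.
rewrite coef_poly; case: ltnP => // ni; rewrite bin_small ?mulr0//.
by rewrite -addnn (leq_trans ni)// leqW// leq_addr.
Qed.

Lemma sin_polyS n : sin_poly n.+1 = sin_poly n + cos_poly n.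
Proof.
apply/polyP => i; rewrite coefD !coef_sin_poly coef_cos_poly binS natrD; ring.
Qed.

Lemma cos_polyS n : cos_poly n.+1 = cos_poly n - sin_poly n * 'X.
Proof.
apply/polyP => -[|i]; rewrite coefB coefMX !coef_cos_poly ?coef_sin_poly/=.
  by rewrite !bin0 subr0.
by rewrite doubleS binS natrD exprS; ring.
Qed.

Lemma sin_cosMn x n : cos x != 0 ->
  sin (x *+ n) = cos x ^+ n * tan x * (sin_poly n).[tan x ^+ 2] /\
  cos (x *+ n) = cos x ^+ n * (cos_poly n).[tan x ^+ 2].
Proof.
move=> cx; have : sin x = cos x * tan x by rewrite /tan mulrC divfK.
move: (tan x) => t sE.
elim: n => [|n [sn cn]].
  rewrite mulr0n sin0 cos0 expr0 !mul1r.
  have -> : sin_poly 0 = 0.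
    by apply/polyP => i; rewrite coef_sin_poly coef0 bin0n mulr0.
  have -> : cos_poly 0 = 1.
    by apply/polyP => -[|i]; rewrite coef_cos_poly coef1 bin0n ?mulr0// mulr1.
  by rewrite horner0 mulr0 hornerC.
rewrite mulrS sinD cosD sn cn sin_polyS cos_polyS sE.
rewrite !(hornerD, hornerN, hornerM, hornerX).
rewrite [cos x ^+ n.+1]exprS; move: (cos_poly n).[_] (sin_poly n).[_] (cos x ^+ n) => P Q w.
by split; ring.
Qed.

Lemma sin_pi_mulrn n : sin (pi *+ n : R) = 0.
Proof. by rewrite -[pi *+ n]add0r (alternatingn (@sinDpi R)) sin0 mulr0. Qed.

Lemma sin_le_id x : 0 <= x -> sin x <= x.
Proof.
move=> x0; rewrite -subr_ge0.
have df y : y \in `]0, x[%R -> is_derive y 1 (fun y => y - sin y) (1 - cos y).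
  by move=> _; exact: is_deriveB.
have [|c _] := MVT_segment x0 df.
  by apply: continuous_subspaceT => y; apply: cvgB; [exact: cvg_id|exact: continuous_sin].
by rewrite sin0 !subr0 => ->; rewrite mulr_ge0// subr_ge0 cos_le1.
Qed.

(** The derivative of [sin y - y * cos y] is [y * sin y], nonnegative on [0, pi]. *)
Lemma id_cos_le_sin x : 0 <= x <= pi -> x * cos x <= sin x.
Proof.
move=> /andP[x0 xpi]; rewrite -subr_ge0.
have df y : y \in `]0, x[%R -> is_derive y 1 (fun y => sin y - y * cos y) (y * sin y).
  by move=> _; apply: is_derive_eq; rewrite /GRing.scale/= mulr1; ring.
have [|c] := MVT_segment x0 df.
  apply: continuous_subspaceT => y; apply: cvgB; first exact: continuous_sin.
  by apply: cvgM; [exact: cvg_id|exact: continuous_cos].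
rewrite in_itv/= sin0 mul0r !subr0 => /andP[c0 cx] ->.
by rewrite !mulr_ge0// sin_ge0_pi// c0 (le_trans cx).
Qed.

(** 1/tan^2 is both 1/sin^2 - 1 and cos^2/sin^2: sin x <= x bounds the first form below, x cos x <=
    sin x bounds the second above. *)
Lemma tan_sqrV_bounds x : 0 < x < pi / 2 ->
  x ^- 2 - 1 <= (tan x ^+ 2)^-1 <= x ^- 2.
Proof.
move=> /andP[x0 xpi].
have sx0 : 0 < sin x by rewrite sin_gt0_pihalf ?x0.
have cx0 : 0 < cos x.
  by rewrite cos_gt0_pihalf// xpi andbT (lt_trans _ x0)// oppr_lt0 divr_gt0// pi_gt0.
have xle : x * cos x <= sin x.
  rewrite id_cos_le_sin// (ltW x0)/= (le_trans (ltW xpi))//.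
  by rewrite ler_pdivrMr// ler_peMr ?pi_ge0// ler1n.
have sle := sin_le_id (ltW x0).
have -> : (tan x ^+ 2)^-1 = (sin x ^+ 2)^-1 * cos x ^+ 2.
  by rewrite /tan; field; rewrite !gt_eqF.
apply/andP; split.
  rewrite cos2sin2 mulrBr mulr1 mulVf ?expf_neq0 ?gt_eqF// lerB//.
  by rewrite lef_pV2 ?posrE ?exprn_gt0// lerXn2r// nnegrE ltW.
rewrite -exprVn -exprMn -exprVn lerXn2r// ?nnegrE ?invr_ge0 ?(ltW x0)//.
  by rewrite mulr_ge0 ?invr_ge0 ?ltW.
by rewrite mulrC ler_pdivrMr// mulrC ler_pdivlMr// mulrC.
Qed.

(** For j < N these are the zeros of sin((2N+1)x) in (0, pi/2), numbered from 0. *)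
Definition angle N j : R := j.+1%:R * pi / N.*2.+1%:R.

Lemma angle_bounds N j : (j < N)%N -> 0 < angle N j < pi / 2.
Proof.
move=> jN; rewrite /angle !divr_gt0 ?mulr_gt0 ?pi_gt0//=.
rewrite ltr_pdivrMr// [ltLHS]mulrC -mulrA ltr_pM2l ?pi_gt0//.
rewrite [ltRHS]mulrC ltr_pdivlMr// -natrM ltr_nat muln2 ltnS.
by rewrite leq_double.
Qed.

(** By [sin_cosMn], [sin_poly] of index 2N+1 vanishes at the squared tangents of these angles, so
    its coefficients give the symmetric functions of their inverses. *)
Lemma esymf_cot N k :
  esymf (fun j => (tan (angle N j) ^+ 2)^-1) N k =
  'C(N.*2.+1, k.*2.+1)%:R / N.*2.+1%:R.
Proof.
set M := N.*2.+1.
have p0 : (sin_poly M)`_0 = M%:R by rewrite coef_sin_poly mul1r bin1.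
have M0 : M%:R != 0 :> R by rewrite pnatr_eq0.
have anglepi j : (j < N)%N -> angle N j \in `](- (pi / 2)), (pi / 2)[%R.
  move=> /angle_bounds/andP[t0 tp]; rewrite in_itv/= tp andbT.
  by rewrite (lt_trans _ t0)// oppr_lt0 divr_gt0// pi_gt0.
have tan_gt0 j : (j < N)%N -> 0 < tan (angle N j).
  move=> jN; rewrite divr_gt0 ?sin_gt0_pihalf ?angle_bounds//.
  by rewrite cos_gt0_pihalf//; have := anglepi _ jN; rewrite in_itv.
have /(_ k) := @coef_esymf_roots (sin_poly M) (fun j => tan (angle N j) ^+ 2) N.
rewrite p0 => /(_ _ M0) H.
have {H} E : (sin_poly M)`_k =
    M%:R * esymf (fun j => - (tan (angle N j) ^+ 2)^-1) N k.
  apply: H.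
  (* Beyond degree N the binomials C(2N+1, 2i+1) vanish. *)
  - apply/leq_sizeP => i Ni; rewrite coef_sin_poly bin_small ?mulr0//.
    by rewrite ltnS ltn_double.
  - move=> j jN; have tj := tan_gt0 _ jN.
    have cj : cos (angle N j) != 0.
      by rewrite gt_eqF// cos_gt0_pihalf//; have := anglepi _ jN; rewrite in_itv.
    have ct : cos (angle N j) ^+ M * tan (angle N j) != 0.
      by rewrite mulf_neq0 ?expf_neq0// gt_eqF.
    have s0 : sin (angle N j *+ M) = 0.
      by rewrite -mulr_natr /angle divfK// mulr_natl sin_pi_mulrn.
    have [+ _] := sin_cosMn M cj; rewrite s0 => E.
    by apply/rootP/(mulfI ct); rewrite mulr0 -E.
  (* The tangents are positive, so equal squares force equal tangents, hence equal angles. *)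
  - move=> i j; rewrite !inE => iN jN /eqP.
    rewrite eqf_sqr => /orP[/eqP/tan_inj|].
      move=> /(_ (anglepi _ iN) (anglepi _ jN)) /(congr1 (fun x => x * M%:R / pi)).
      rewrite /angle !divfK// !mulfK ?gt_eqF ?pi_gt0// => /eqP.
      by rewrite eqr_nat => /eqP[].
    by rewrite gt_eqF// (lt_trans _ (tan_gt0 _ iN))// oppr_lt0 tan_gt0.
rewrite coef_sin_poly in E.
apply: (mulfI M0); rewrite [RHS]mulrC divfK//.
(* The sign of the coefficient cancels the one produced by the negated arguments. *)
apply: (@mulfI _ ((-1) ^+ k)); first by rewrite signr_eq0.
rewrite E mulrCA -esymfZ; congr (_ * esymf _ _ _).
by apply/funext => j; rewrite mulN1r.
Qed.

End sine_polynomials.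

(** * The limit of the elementary symmetric functions of 1/j^2 *)

Section zeta_two_limits.
Variable R : realType.
Implicit Types (x y : nat -> R) (N k : nat).

Lemma esymf_ge0 x N k : (forall j, (j < N)%N -> 0 <= x j) -> 0 <= esymf x N k.
Proof.
move=> x0; rewrite esymf_sum; apply: sumr_ge0 => m _; apply: prodr_ge0 => i _.
exact: x0.
Qed.

Lemma ler_esymf x y N k :
  (forall j, (j < N)%N -> 0 <= x j <= y j) -> esymf x N k <= esymf y N k.
Proof.
move=> xy; rewrite !esymf_sum; apply: ler_sum => m _.
by apply: ler_prod => i _; exact: xy.
Qed.

Lemma esymf_nondecreasing x k : (forall j, 0 <= x j) ->
  {homo (fun N => esymf x N k) : M N / (M <= N)%N >-> M <= N}.
Proof.
move=> x0; apply: homo_leq => [||N]; [by []|exact: le_trans|].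
by case: k => [|k]; rewrite ?esymfS0// esymfSS lerDl mulr_ge0// esymf_ge0.
Qed.

Lemma cvg_esymf (u : nat -> nat -> R) x N k :
  (forall j, u^~ j @ \oo --> x j) ->
  (fun i => esymf (u i) N k) @ \oo --> esymf x N k.
Proof.
move=> ux; elim: N k => [|N IH] [|k].
- by under eq_fun do rewrite esymfn0; rewrite esymfn0; exact: cvg_cst.
- by under eq_fun do rewrite esymf0n; rewrite esymf0n; exact: cvg_cst.
- by under eq_fun do rewrite esymfn0; rewrite esymfn0; exact: cvg_cst.
under eq_fun do rewrite esymfSS; rewrite esymfSS.
by apply: cvgD => //; apply: cvgM.
Qed.

Let oddV N : R := N.*2.+1%:R^-1.

Let cvg_oddV : oddV @ \oo --> (0 : R).
Proof.
apply: (squeeze_cvgr _ (cvg_cst 0) (@cvg_harmonic R)); apply: nearW => N.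
rewrite invr_ge0 ler0n/= lef_pV2 ?posrE// ler_nat ltnS -addnn leq_addr//.
Qed.

(** With M = 2N+1, the falling factorial of M of length [k] is a product of [k] factors, each
    asymptotic to M. *)
Let cvg_bin_odd k :
  (fun N => 'C(N.*2.+1, k)%:R * oddV N ^+ k : R) @ \oo --> (k`!%:R^-1 : R).
Proof.
have H : (fun N => (N.*2.+1 ^_ k)%:R * oddV N ^+ k : R) @ \oo --> (1 : R).
  elim: k => [|k IH].
    by under eq_fun do rewrite ffactn0 mul1r expr0; exact: cvg_cst.
  have E : (fun N => ((N.*2.+1 ^_ k)%:R * oddV N ^+ k) * (1 - k%:R * oddV N)) @ \oo -->
      (1 * (1 - k%:R * 0) : R).
    apply: cvgM => //; apply: cvgB; first exact: cvg_cst.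
    by apply: cvgM => //; exact: cvg_cst.
  (* The new factor (M - k)/M equals 1 - k/M only once k <= M, natural subtraction being truncated;
     hence an eventual equality. *)
  rewrite mulr0 subr0 mulr1 in E; apply: cvg_trans E; apply: near_eq_cvg.
  near=> N.
  have kN : (k <= N.*2.+1)%N.
    have kN' : (k <= N)%N by near: N; exact: nbhs_infty_ge.
    by rewrite (leq_trans kN')// leqW// -addnn leq_addr.
  rewrite ffactnSr natrM natrB// exprSr.
  have : N.*2.+1%:R * oddV N = 1 by rewrite /oddV mulfV// pnatr_eq0.
  move: (N.*2.+1%:R) (oddV N) (N.*2.+1 ^_ k)%:R => M o A Mo.
  by rewrite -[X in X - _]Mo; move: (o ^+ k) => p; ring.
have : (fun N => ((N.*2.+1 ^_ k)%:R * oddV N ^+ k) * k`!%:R^-1 : R) @ \oo -->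
    (1 * k`!%:R^-1 : R) by apply: cvgM => //; exact: cvg_cst.
rewrite mul1r; apply: cvg_trans; apply: near_eq_cvg; near=> N.
by rewrite -bin_ffact natrM mulrAC mulfK// pnatr_eq0 -lt0n fact_gt0.
Unshelve. all: by end_near. Qed.

(** The scaling turns 1/angle^2 into exactly 1/(j+1)^2. *)
Let w N j : R := (pi * oddV N) ^+ 2 * (tan (angle R N j) ^+ 2)^-1.

Let w_bounds N j : (j < N)%N ->
  (j.+1%:R ^+ 2)^-1 - (pi * oddV N) ^+ 2 <= w N j <= (j.+1%:R ^+ 2)^-1.
Proof.
move=> jN; have /andP[lo up] := tan_sqrV_bounds (angle_bounds R jN).
have E : (pi * oddV N) ^+ 2 * angle R N j ^- 2 = (j.+1%:R ^+ 2)^-1.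
  have M0 : N.*2.+1%:R != 0 :> R by rewrite pnatr_eq0.
  have j0 : j.+1%:R != 0 :> R by rewrite pnatr_eq0.
  have p0 : pi != 0 :> R by rewrite gt_eqF// pi_gt0.
  rewrite /oddV /angle; move: (N.*2.+1%:R) (j.+1%:R) pi M0 j0 p0 => M i p M0 i0 p0.
  by field; rewrite M0 i0 p0.
rewrite /w -E; apply/andP; split; last by rewrite ler_wpM2l ?sqr_ge0.
by rewrite -[X in _ - X]mulr1 -mulrBr ler_wpM2l ?sqr_ge0.
Qed.

Let esymf_w N k : esymf (w N) N k =
  pi ^+ (2 * k) * ('C(N.*2.+1, k.*2.+1)%:R * oddV N ^+ k.*2.+1).
Proof.
rewrite /w esymfZ esymf_cot -exprM exprMn [oddV N ^+ k.*2.+1]exprSr -(mul2n k).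
by rewrite -/(oddV N) -!mulrA; congr (_ * _); rewrite mulrCA.
Qed.

(** Squeezed between [esymf (w N) N k], which has this limit by the binomial asymptotics, and the
    limit itself. *)
Lemma cvg_esymf_zeta2 k :
  (fun N => esymf (fun j => (j.+1%:R ^+ 2)^-1 : R) N k) @ \oo -->
  (pi ^+ (2 * k) / (2 * k + 1)`!%:R : R).
Proof.
set x := (fun j => (j.+1%:R ^+ 2)^-1); set L : R := _ / _.
have x0 j : 0 <= x j by rewrite /x invr_ge0 exprn_ge0.
have w0 N j : 0 <= w N j by rewrite /w mulr_ge0 ?sqr_ge0 ?invr_ge0 ?sqr_ge0.
have cL : (fun N => esymf (w N) N k) @ \oo --> L.
  under eq_fun do rewrite esymf_w.
  rewrite /L addn1 mul2n -mul2n; apply: cvgM; first exact: cvg_cst.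
  by rewrite mul2n; exact: cvg_bin_odd.
have cw j : w^~ j @ \oo --> x j.
  have cl : (fun N => x j - (pi * oddV N) ^+ 2) @ \oo --> x j.
    have : (fun N => x j - (pi * oddV N) ^+ 2) @ \oo --> x j - (pi * 0) ^+ 2.
      apply: cvgB; first exact: cvg_cst.
      rewrite expr2; under eq_fun do rewrite expr2.
      by apply: cvgM; apply: cvgM => //; exact: cvg_cst.
    by rewrite mulr0 expr0n subr0.
  apply: (squeeze_cvgr _ cl (cvg_cst (x j))); near=> N.
  by apply: w_bounds; near: N; exact: nbhs_infty_gt.
(* For fixed [M] and large [N], [esymf (w N) M k <= esymf (w N) N k]; as [N] grows the left side
   tends to [esymf x M k] and the right side to [L]. *)
have up M : esymf x M k <= L.
  have H := @cvg_esymf w x M k cw; apply: (ler_cvg_to H cL); near=> N.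
  by apply: esymf_nondecreasing => //; near: N; exact: nbhs_infty_ge.
apply: (squeeze_cvgr _ cL (cvg_cst L)); apply: nearW => N.
rewrite up andbT; apply: ler_esymf => j jN; rewrite w0/=.
by have /andP[] := w_bounds jN.
Unshelve. all: by end_near. Qed.

End zeta_two_limits.

(** * Bernoulli polynomials at 1/2 and the expansion of t / sinh t *)

Section bernoulli_half.
Variable R : realType.
Implicit Types (a b : nat -> R) (n : nat).

(** If the coefficients before [a n] vanish, division by t^(n+1) leaves a tail with sum -a_n/t; this
    tail is bounded near 0, which forces a_n = 0. *)
Lemma pseries_eq0 a :
    (\forall t \near 0^', series (fun n => a n * t ^+ n) @ \oo --> (0 : R)) ->
  forall n, a n = 0.
Proof.
move=> a0; elim/ltn_ind => n IH.
have [e e0 ae] : exists2 e : R, 0 < e & forall t : R, 0 < t <= e ->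
    series (fun n => a n * t ^+ n) @ \oo --> (0 : R).
  move: a0 => /nbhs_ballP[e /= e0 ae]; exists (e / 2); first by rewrite divr_gt0.
  move=> t /andP[t0 te]; apply: ae; last by rewrite gt_eqF.
  rewrite /ball/= sub0r normrN gtr0_norm// (le_lt_trans te)//.
  by rewrite ltr_pdivrMr// ltr_pMr// ltr1n.
pose c m := a (m + n.+1)%N.
have shift (t : R) : 0 < t <= e ->
    series (fun m => c m * t ^+ m) @ \oo --> - (a n / t).
  move=> te; have /andP[t0 _] := te; have := ae t te.
  rewrite -(cvg_shiftn n.+1) => H.
  have -> : series (fun m => c m * t ^+ m) =
      fun N => (series (fun m => a m * t ^+ m) (N + n.+1)%N - a n * t ^+ n) * t ^- n.+1.
    apply/funext => N; rewrite /series/=.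
    rewrite [in RHS](@big_cat_nat _ _ _ n.+1)//= ?leq_addl// [in RHS]big_nat_recr//=.
    have -> : \sum_(0 <= i < n) a i * t ^+ i = 0.
      by rewrite big_nat big1// => i /= /IH ->; rewrite mul0r.
    rewrite add0r.
    rewrite addrAC subrr add0r -[X in (\sum_(X <= _ < _) _) / _]add0n big_addn addnK mulr_suml.
    apply: eq_bigr => i _; rewrite exprD mulrA mulfK// expf_neq0// gt_eqF//.
  have -> : - (a n / t) = (0 - a n * t ^+ n) * t ^- n.+1.
    rewrite exprS; have : t ^+ n != 0 by rewrite expf_neq0// gt_eqF.
    move: (t ^+ n) => p p0; field; rewrite p0 gt_eqF//.
  by apply: cvgM; [apply: cvgB => //; exact: cvg_cst|exact: cvg_cst].
have ce : cvgn (pseries c e).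
  by apply/cvg_ex; exists (- (a n / e)); apply: shift; rewrite e0 lexx.
(* Convergence at [e] gives absolute convergence at [e / 2], hence one bound [K] for the tail on all
   of (0, e/2]. *)
have cn : cvgn (pseries (fun i => `|c i|) (e / 2)).
  apply: is_cvg_pseries_inside_norm ce _; rewrite !gtr0_norm ?divr_gt0//.
  by rewrite ltr_pdivrMr// ltr_pMr// ltr1n.
set K : R := limn (pseries (fun i => `|c i|) (e / 2)).
have bound (t : R) : 0 < t <= e / 2 -> `|a n| <= K * t.
  move=> /andP[t0 te]; rewrite -ler_pdivrMr//.
  have te' : 0 < t <= e.
    by rewrite t0 (le_trans te)// ler_pdivrMr// ler_peMr ?ler1n// ltW.
  have -> : `|a n| / t = `|- (a n / t)|.
    by rewrite normrN normrM normfV (gtr0_norm t0).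
  have H : (fun N => `|series (fun m => c m * t ^+ m) N|) @ \oo --> `|- (a n / t)|.
    by apply: cvg_norm; exact: shift.
  apply: (ler_cvg_to H cn); apply: nearW => N.
  rewrite (le_trans (ler_norm_sum _ _ _))// ler_sum// => i _.
  rewrite normrM ler_wpM2l// normrX lerXn2r ?nnegrE ?divr_ge0 ?(ltW e0)//.
  by rewrite gtr0_norm.
apply/eqP/negPn/negP => an0.
have K0 : 0 < K.
  rewrite -(@pmulr_lgt0 _ (e / 2)) ?divr_gt0//.
  by rewrite (lt_le_trans _ (bound _ _)) ?normr_gt0// divr_gt0//= lexx.
(* The second argument makes [K * t] at most half of |a_n|, against [bound]. *)
pose t := Num.min (e / 2) (`|a n| / (2 * K)).
have t0 : 0 < t by rewrite lt_min !divr_gt0 ?normr_gt0 ?mulr_gt0.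
have /bound : 0 < t <= e / 2 by rewrite t0 ge_min lexx.
apply/negP; rewrite -ltNge.
have : K * t <= `|a n| / 2.
  rewrite mulrC -ler_pdivlMr// -mulrA -invfM ge_min; apply/orP; right.
  by rewrite lexx.
by move=> /le_lt_trans; apply; rewrite ltr_pdivrMr// ltr_pMr ?normr_gt0// ltr1n.
Qed.

(* The coefficient of t^n in t / sinh t. *)
Definition bernoulli_half n : R := 2 ^+ n * (bernoulli_poly R n).[2^-1] / n`!%:R.

(** The series of t / sinh t times that of e^t - e^(-t) is 2t; the identity compares coefficients of
    t^(2n+1), halved. *)
Lemma bernoulli_half_conv n :
  \sum_(q < n.+1) bernoulli_half (2 * q) / (2 * (n - q) + 1)`!%:R = (n == 0)%:R.
Proof.
(* [u] lists the coefficients of e^t - e^(-t), and [d] those of the product minus 2t. *)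
pose u m : R := (1 - (-1) ^+ m) / m`!%:R.
pose b := bernoulli_half.
pose d m := \sum_(i < m.+1) b i * u (m - i)%N - 2 * (m == 1)%:R.
have d0 : forall m, d m = 0.
  apply: pseries_eq0.
  (* The generating function at x = 1/2 is evaluated at 2t, which halves the radius. *)
  have [e /= e0 He] : exists2 e : R, 0 < e & forall t : R, 0 < `|t| < e ->
      series (fun m => b m * t ^+ m) @ \oo -->
        2 * t * expR t / (expR (2 * t) - 1).
    have /nbhs_ballP[e /= e0 He] := @bernoulli_polyP R 2^-1.
    exists (e / 2); first by rewrite divr_gt0.
    move=> t /andP[t0 te]; have := He (2 * t).
    rewrite mulrA mulVf// mul1r.
    have -> : (fun m => b m * t ^+ m) =
        (fun m => (bernoulli_poly R m).[2^-1] * (2 * t) ^+ m / m`!%:R).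
      apply/funext => m; rewrite /b /bernoulli_half exprMn.
      by rewrite -!mulrA mulrCA; congr (_ * (_ * _)); rewrite mulrC.
    apply; last by rewrite mulf_neq0// -normr_gt0.
    rewrite /ball/= sub0r normrN normrM ger0_norm// mulrC -ltr_pdivlMr//.
  exists (e / 2) => /=; first by rewrite divr_gt0.
  move=> t; rewrite /ball/= sub0r normrN => te tn0.
  have t0 : 0 < `|t| by rewrite normr_gt0.
  have te' : 0 < `|t| < e.
    by rewrite t0 (lt_trans te)// ltr_pdivrMr// ltr_pMr// ltr1n.
  have cb : cvgn [normed series (fun m => b m * t ^+ m)].
    have ch : cvgn (pseries b (e / 2)).
      apply/cvg_ex; eexists; apply: He; rewrite gtr0_norm ?divr_gt0//=.
      by rewrite ltr_pdivrMr// ltr_pMr// ltr1n.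
    have := @is_cvg_pseries_inside_norm _ _ _ `|t| ch.
    rewrite normr_id (gtr0_norm (_ : 0 < e / 2)) ?divr_gt0// => /(_ te).
    rewrite (_ : [normed series _] = pseries (fun i => `|b i|) `|t|)//.
    apply/funext => N; rewrite /pseries /series/=; apply: eq_bigr => m _.
    by rewrite [LHS]normrM normrX.
  have cve y : cvgn [normed series (exp_coeff y : R^nat)].
    by rewrite normed_series_exp_coeff; exact: is_cvg_series_exp_coeff.
  have uE : (fun m => u m * t ^+ m) = exp_coeff t - exp_coeff (- t).
    apply/funext => m; rewrite /u /exp_coeff/= !fctE [(- t) ^+ m]exprNn; ring.
  have limu : series (fun m => u m * t ^+ m) @ \oo --> expR t - expR (- t).
    rewrite uE; have -> : series (exp_coeff t - exp_coeff (- t) : R^nat) =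
        series (exp_coeff t) - series (exp_coeff (- t)).
      by apply/funext => m; rewrite /series/= !fctE sumrB.
    by apply: cvgB; exact: is_cvg_series_exp_coeff.
  have cu : cvgn [normed series (fun m => u m * t ^+ m)].
    have cc := is_cvgD (cve t) (cve (- t)).
    apply: (@series_le_cvg _ _ (fun m => `|exp_coeff t m| + `|exp_coeff (- t) m|)).
    - by move=> m; exact: normr_ge0.
    - by move=> m; exact: addr_ge0.
    - move=> m /=; rewrite (_ : u m * t ^+ m = exp_coeff t m - exp_coeff (- t) m).
        exact: ler_normB.
      by rewrite -[LHS]/((fun m => u m * t ^+ m) m) uE.
    rewrite (_ : series _ =
      [normed series (exp_coeff t)] + [normed series (exp_coeff (- t))]); first exact: cc.
    by rewrite funeqE => m; rewrite /series/= !fctE big_split.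
  have := cauchy_product cb cu.
  rewrite (cvg_lim _ limu)// (cvg_lim _ (He t te'))//.
  have -> : 2 * t * expR t / (expR (2 * t) - 1) * (expR t - expR (- t)) = 2 * t.
    have et : expR t != 0 by rewrite gt_eqF// expR_gt0.
    have e2 : expR (2 * t) - 1 != 0.
      by rewrite subr_eq0 -expR0 (inj_eq (@expR_inj R)) mulf_neq0.
    move: e2; rewrite -[2]/(1 + 1) mulrDl mul1r expRD expRN => e2.
    by field; rewrite et e2.
  move=> H; have H1 : series (fun m => 2 * (m == 1)%:R * t ^+ m) @ \oo --> 2 * t.
    apply: cvg_near_cst; exists 2 => // -[|[|N]]// _.
    rewrite /series/= 2?big_nat_recl//= big1 ?addr0.
      by rewrite mulr0 mul0r add0r mulr1 expr1.
    by move=> i _; rewrite mulr0 mul0r.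
  have H2 := cvgB H H1; rewrite subrr in H2.
  rewrite (_ : series _ = series (fun m =>
      \sum_(i < m.+1) b i * t ^+ i * (u (m - i)%N * t ^+ (m - i))) -
    series (fun m => 2 * (m == 1)%:R * t ^+ m)); first exact: H2.
  apply/funext => N; rewrite /series/= !fctE -sumrB.
  apply: eq_bigr => m _; rewrite /d mulrBl; congr (_ - _).
  rewrite mulr_suml; apply: eq_bigr => i _.
  have im : (i <= m)%N by rewrite -ltnS.
  have -> : t ^+ m = t ^+ i * t ^+ (m - i) by rewrite -exprD subnKC.
  ring.
have := d0 (2 * n).+1; rewrite /d => /eqP; rewrite subr_eq0 => /eqP.
(* Pairs the indices 2q and 2q+1; the odd ones meet [u] at an even index, where it vanishes. *)
have dbl m (F : nat -> R) :
    \sum_(i < (2 * m).+2) F i = \sum_(q < m.+1) (F (2 * q)%N + F (2 * q).+1).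
  elim: m => [|m IH]; first by rewrite !big_ord_recr !big_ord0/= !add0r.
  by rewrite mulnS !add2n 2!big_ord_recr IH [in RHS]big_ord_recr/= mulnS !add2n addrA.
rewrite (dbl n (fun i => b i * u ((2 * n).+1 - i)%N)) => H.
have -> : (n == 0)%:R = 2^-1 * (2 * ((2 * n).+1 == 1)%:R) :> R.
  by rewrite mulrA mulVf// mul1r eqSS muln_eq0.
rewrite -H mulr_sumr; apply: eq_bigr => q _.
have qn : (q <= n)%N by rewrite -ltnS.
rewrite subSS -mulnBr subSn ?leq_mul// -mulnBr /u.
have sgn m : (-1) ^+ (2 * m) = 1 :> R by rewrite exprM sqrrN !expr1n.
rewrite exprS !sgn mulr1 opprK subrr mul0r mulr0 addr0 addn1 -/b.
by rewrite mulrCA; congr (_ * _); rewrite mulrA mulVf// mul1r.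
Qed.

End bernoulli_half.

(** * Generating polynomials of the truncated sums *)

Section truncated_sums.
Variable A : comNzRingType.
Variables (D : nat) (x : nat -> A).
Implicit Types (N k n : nat).

(** The exponents start at 1 because the parts of a composition are positive; cutting the geometric
    series at [D] changes no coefficient up to t^D. *)
Definition geom_poly j : {poly A} := \sum_(1 <= a < D.+1) (x j ^+ a) *: 'X^a.

Let lin N : {poly A} := \prod_(j < N) (1 - x j *: 'X).

Let mul_geom_poly j :
  (1 - x j *: 'X) * geom_poly j = x j *: 'X - (x j ^+ D.+1) *: 'X^(D.+1).
Proof.
rewrite /geom_poly; elim: D => [|d IH].
  by rewrite big_geq// mulr0 expr1 expr1 subrr.
rewrite big_nat_recr//= mulrDr IH mulrBl mul1r -scalerAl -scalerAr scalerA -!exprS.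
by rewrite addrA subrK.
Qed.

Let coef_lin N i : (lin N)`_i = (-1) ^+ i * esymf x N i.
Proof.
rewrite -esymfZ /lin /esymf; congr ((_ : {poly _})`_i).
by apply: eq_bigr => j _; rewrite mulN1r scaleNr.
Qed.

(** The product of the 1 - (1 - s) x_j t has (s - 1)^n e_n as coefficient of t^n, and the binomial
    theorem extracts s^k. The proof avoids s by induction on [N] with Pascal's rule. The exponent
    [n + k] has the parity of n - k without truncated subtraction. *)
Let coef_lin_esymf N k n : (n <= D)%N ->
  (lin N * esymf geom_poly N k)`_n = (-1) ^+ (n + k) * 'C(n, k)%:R * esymf x N n.
Proof.
elim: N k n => [|N IH] k n nD.
  rewrite /lin big_ord0 mul1r !esymf0n coefMn coef1.
  case: n nD => [|n] _; last by rewrite mul0rn mulr0.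
  case: k => [|k]; rewrite bin0n mulr1 /= ?mulr0//.
  by rewrite expr0 mulr1.
case: k => [|k]; first by rewrite esymfn0 mulr1 coef_lin addn0 bin0 mulr1.
rewrite /lin big_ord_recr/= -/(lin N) esymfSS.
(* Brings [geom_poly N] next to its own linear factor, where the product is x_N X up to a term of
   degree D + 1. *)
have -> : lin N * (1 - x N *: 'X) *
      (esymf geom_poly N k.+1 + geom_poly N * esymf geom_poly N k) =
    lin N * esymf geom_poly N k.+1 - (lin N * esymf geom_poly N k.+1) * (x N *: 'X) +
    (lin N * esymf geom_poly N k) * ((1 - x N *: 'X) * geom_poly N) by ring.
rewrite mul_geom_poly mulrBr -!scalerAr !(coefD, coefN, coefZ) coefMXn ltnS nD mulr0 subr0.
rewrite !coefMX; case: n nD => [|n] nD /=.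
  by rewrite !mulr0 subr0 addr0 IH// bin0n mulr0 !mul0r.
rewrite !IH ?(ltnW nD)// binS natrD esymfSS addSn addnS !exprS.
by move: ((-1) ^+ _) => s; ring.
Qed.

(* The factors multiply to (1 - x_j t)(1 + s g_j(t)) = 1 - (1 - s) x_j t modulo
   t^(D+1), where g_j is the truncated geometric series. *)
Lemma esymf_geom_conv N k n : (n <= D)%N ->
  \sum_(i < n.+1) (-1) ^+ i * esymf x N i * (esymf geom_poly N k)`_(n - i) =
  (-1) ^+ (n + k) * 'C(n, k)%:R * esymf x N n.
Proof.
move=> nD; rewrite -coef_lin_esymf// coefM; apply: eq_bigr => i _.
by rewrite coef_lin.
Qed.

End truncated_sums.

(** Associativity of convolution comes from polynomial multiplication; truncating the sequences
    leaves the coefficients up to [n] unchanged. *)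
Lemma conv_inverse (A : comNzRingType) (h a l r : nat -> A) n :
    (forall m, (m <= n)%N -> \sum_(i < m.+1) h i * a (m - i)%N = (m == 0)%:R) ->
    (forall m, (m <= n)%N -> \sum_(i < m.+1) a i * l (m - i)%N = r m) ->
  l n = \sum_(i < n.+1) h i * r (n - i)%N.
Proof.
move=> ha al.
pose P f : {poly A} := \poly_(i < n.+1) f i.
have conv f g m : (m <= n)%N ->
    (P f * P g)`_m = \sum_(i < m.+1) f i * g (m - i)%N.
  move=> mn; rewrite coefM; apply: eq_bigr => i _.
  have im : (i <= m)%N by rewrite -ltnS.
  by rewrite !coef_poly !ltnS (leq_trans im mn) (leq_trans (leq_subr i m) mn).
transitivity ((P h * P a * P l)`_n).
  rewrite coefM big_ord_recl/= conv// ha// mul1r subn0 coef_poly ltnS leqnn.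
  rewrite big1 ?addr0// => i _; rewrite conv ?ha ?mul0r//; exact: (ltn_ord i).
rewrite -mulrA coefM; apply: eq_bigr => i _.
by rewrite conv ?al ?leq_subr// coef_poly ltn_ord.
Qed.

(** * Passage to the limit and inversion of the convolution *)

Section limit_of_truncations.
Variables (R : realType) (D k : nat).

Let x j : R := (j.+1%:R ^+ 2)^-1.
Let e i : R := pi ^+ (2 * i) / (2 * i + 1)`!%:R.
Let G N n : R := (esymf (geom_poly D x) N k)`_n.

(** In [esymf_geom_conv] the term i = 0 is [G N n] itself, and the others involve [G] at smaller
    indices only, so strong induction applies. *)
Let cvgG n : (n <= D)%N -> cvgn (G^~ n).
Proof.
elim/ltn_ind: n => n IH nD.
have -> : G^~ n = fun N => (-1) ^+ (n + k) * 'C(n, k)%:R * esymf x N n -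
    \sum_(i < n) (-1) ^+ i.+1 * esymf x N i.+1 * G N (n - i.+1).
  apply/funext => N; rewrite -(@esymf_geom_conv _ D)// big_ord_recl/= esymfn0.
  by rewrite expr0 !mul1r subn0 addrK.
have cx i : cvgn (fun N => esymf x N i) by apply: cvgP; exact: cvg_esymf_zeta2.
apply: is_cvgB; first by apply: is_cvgM => //; exact: is_cvg_cst.
apply: (cvgP (\sum_(i < n) (-1) ^+ i.+1 * e i.+1 * limn (G^~ (n - i.+1)%N))).
apply: cvg_big => [|i _]; first exact: add_continuous.
apply: cvgM.
  by apply: cvgM; [exact: cvg_cst|exact: cvg_esymf_zeta2].
apply: IH; first by rewrite ltn_subrL/= (leq_ltn_trans _ (ltn_ord i)).
by rewrite (leq_trans _ nD)// leq_subr.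
Qed.

Let lim_conv n : (n <= D)%N ->
  \sum_(i < n.+1) (-1) ^+ i * e i * limn (G^~ (n - i)%N) =
  (-1) ^+ (n + k) * 'C(n, k)%:R * e n.
Proof.
move=> nD.
pose F N : R := \sum_(i < n.+1) (-1) ^+ i * esymf x N i * G N (n - i)%N.
have H1 : F @ \oo --> \sum_(i < n.+1) (-1) ^+ i * e i * limn (G^~ (n - i)%N).
  apply: cvg_big => [|i _]; first exact: add_continuous.
  apply: cvgM; last first.
    by apply: cvgG; rewrite (leq_trans _ nD)// leq_subr.
  by apply: cvgM; [exact: cvg_cst|exact: cvg_esymf_zeta2].
have H2 : (fun N => (-1) ^+ (n + k) * 'C(n, k)%:R * esymf x N n) @ \oo -->
    (-1) ^+ (n + k) * 'C(n, k)%:R * e n.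
  by apply: cvgM; [exact: cvg_cst|exact: cvg_esymf_zeta2].
have FE : F = fun N => (-1) ^+ (n + k) * 'C(n, k)%:R * esymf x N n.
  by apply/funext => N; exact: esymf_geom_conv.
by rewrite FE in H1; exact: (cvg_unique _ H1 H2).
Qed.

Lemma cvg_esymf_geom : (k <= D)%N -> (fun N => (esymf (geom_poly D x) N k)`_D) @ \oo -->
  ((-1) ^+ (D - k) * pi ^+ (2 * D) / (2 * D + 1)`!%:R *
   \sum_(0 <= q < (D - k).+1)
     'C(D - q, k)%:R * 'C(2 * D + 1, 2 * q)%:R * 2 ^+ (2 * q) *
     (bernoulli_poly R (2 * q)).[2^-1] : R).
Proof.
move=> kD; set rhs := (X in _ --> X).
suff <- : limn (G^~ D) = rhs by exact: cvgG.
(* In powers of t^2, [h] lists the coefficients of pi t / sin(pi t), obtained from t / sinh t at i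
   pi t; the [(-1) ^+ i * e i] are those of sin(pi t) / (pi t). *)
pose h q : R := (-1) ^+ q * pi ^+ (2 * q) * bernoulli_half R (2 * q).
rewrite (@conv_inverse _ h (fun i => (-1) ^+ i * e i) (fun n => limn (G^~ n)) _ D _ lim_conv);
  last first.
  move=> m _; transitivity ((-1) ^+ m * pi ^+ (2 * m) *
    \sum_(i < m.+1) bernoulli_half R (2 * i) / (2 * (m - i) + 1)`!%:R).
    rewrite mulr_sumr; apply: eq_bigr => i _.
    have im : (i <= m)%N by rewrite -ltnS.
    have -> : (-1) ^+ m = (-1) ^+ i * (-1) ^+ (m - i) :> R by rewrite -exprD subnKC.
    have -> : pi ^+ (2 * m) = pi ^+ (2 * i) * pi ^+ (2 * (m - i)) :> R.
      by rewrite -exprD -mulnDr subnKC.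
    rewrite /h /e; move: ((-1) ^+ i) ((-1) ^+ (m - i)) => s1 s2.
    move: (pi ^+ (2 * i)) (pi ^+ (2 * (m - i))) (_^-1) => p1 p2 f; ring.
  by rewrite bernoulli_half_conv; case: m => [|m]; rewrite ?mulr0// muln0 !expr0 !mulr1.
rewrite /rhs -(big_mkord xpredT
  (fun q => h q * ((-1) ^+ (D - q + k) * 'C(D - q, k)%:R * e (D - q)%N))).
(* For q > D - k the binomial C(D - q, k) vanishes. *)
rewrite (@big_cat_nat _ _ _ (D - k).+1)//= ?ltnS ?leq_subr//.
rewrite [X in _ + X]big_nat [X in _ + X]big1 ?addr0; last first.
  move=> q /andP[Dkq qD]; rewrite [in X in _ * X]bin_small ?mulr0 ?mul0r ?mulr0//.
  by rewrite ltn_subLR// addnC -ltn_subLR.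
rewrite mulr_sumr !big_nat; apply: eq_bigr => q /= qDk.
have qD : (q <= D)%N by rewrite (leq_trans _ (leq_subr k D)).

have E : 'C(2 * D + 1, 2 * q)%:R =
    (2 * D + 1)`!%:R / ((2 * q)`!%:R * (2 * (D - q) + 1)`!%:R) :> R.
  have f0 m : m`!%:R != 0 :> R by rewrite pnatr_eq0 -lt0n fact_gt0.
  have le : (2 * q <= 2 * D + 1)%N by rewrite (leq_trans _ (leq_addr _ _))// leq_mul.
  rewrite -(bin_fact le) !natrM (_ : 2 * D + 1 - 2 * q = 2 * (D - q) + 1)%N.
    by rewrite mulfK// mulf_neq0.
  by rewrite addnC -addnBA ?leq_mul// -mulnBr addnC.
(* The two exponents are D - k and D + k, of equal parity. *)
have sgn : (-1) ^+ (D - k) = (-1) ^+ q * (-1) ^+ (D - q + k) :> R.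
  rewrite -exprD addnA subnKC// -signr_odd -[RHS]signr_odd oddD oddB//.
have pe : pi ^+ (2 * D) = pi ^+ (2 * q) * pi ^+ (2 * (D - q)) :> R.
  by rewrite -exprD -mulnDr subnKC.
rewrite E sgn pe /h /e /bernoulli_half.
have f0 m : m`!%:R != 0 :> R by rewrite pnatr_eq0 -lt0n fact_gt0.
move: (f0 (2 * D + 1)%N) (f0 (2 * q)%N) (f0 (2 * (D - q) + 1)%N).
move: (2 * D + 1)`!%:R (2 * q)`!%:R (2 * (D - q) + 1)`!%:R => f1 f2 f3 f10 f20 f30.
move: (_.[_]) (2 ^+ _) (pi ^+ (2 * q)) (pi ^+ (2 * (D - q))).
move: ((-1) ^+ q) ((-1) ^+ (D - q + k)) 'C(D - q, k)%:R.
move=> *.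
by field; rewrite f10 f20 f30.
Qed.

End limit_of_truncations.

(** * Multiple zeta values as limits of truncated sums *)

Section truncated_mzv.
Variables (R : realType) (r : nat) (alpha : 'I_r -> nat).

Let a (m : {ffun 'I_r -> nat}) : R := \prod_(i < r) (m i)%:R ^- alpha i.

(** An index in ['I_N] stands for its successor, so the entries run over 1, ..., N. *)
Definition mzv_trunc N : R :=
  \sum_(m : {ffun 'I_r -> 'I_N} | increasing m) \prod_(i < r) (m i).+1%:R ^- alpha i.

Let S := [set m : {ffun 'I_r -> nat} |
  (forall i, (0 < m i)%N) /\ {homo m : i j / (i < j)%N}].

Let shift N (m : {ffun 'I_r -> 'I_N}) : {ffun 'I_r -> nat} := [ffun i => (m i).+1].

Let S_ N := [set shift m | m in [set` @increasing r N]].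

Let shift_inj N : injective (@shift N).
Proof.
move=> m m' /ffunP mm'; apply/ffunP => i; apply/val_inj.
by have := mm' i; rewrite !ffunE => -[].
Qed.

Let finite_S_ N : finite_set (S_ N).
Proof. exact/finite_image/finite_finset. Qed.

Let S_P N m : S_ N m <-> S m /\ forall i, (m i <= N)%N.
Proof.
split=> [[m' /= /increasingP mi <-]|[[m0 mi] mN]].
  by split=> [|i]; [split=> [i|i j ij]|]; rewrite !ffunE// ltnS mi.
have mN' i : ((m i).-1 < N)%N by rewrite prednK.
exists [ffun i => Ordinal (mN' i)]; last first.
  by apply/ffunP => i; rewrite !ffunE/= prednK.
apply/increasingP => i j ij; rewrite !ffunE/=.
by rewrite -ltnS !prednK// mi.
Qed.

Let sum_S_ N : (\sum_(m \in S_ N) (a m)%:E = (mzv_trunc N)%:E)%E.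
Proof.
rewrite fsbig_image; last by move=> m m' _ _; exact: shift_inj.
rewrite -(bigfs _ (r := index_enum _)) ?index_enum_uniq//; last first.
  by move=> m _; rewrite mem_index_enum.
rewrite sumEFin; congr EFin; apply: eq_bigr => m _; apply: eq_bigr => i _.
by rewrite ffunE.
Qed.

Let a_ge0 m : 0 <= a m.
Proof. by apply: prodr_ge0 => i _; rewrite invr_ge0 exprn_ge0. Qed.

(** A finite set of admissible tuples has bounded entries, so it lies in some [S_ N], which is
    itself finite. *)
Let mzvE : mzv R alpha = ereal_sup (range (EFin \o mzv_trunc)).
Proof.
apply/eqP; rewrite eq_le; apply/andP; split.
  apply: ge_ereal_sup => _ [A [finA AS] <-].
  have [N AN] : exists N, forall m i, A m -> (m i <= N)%N.
    exists (\max_(m <- finmap.enum_fset (fset_set A)) \max_i m i) => m i Am.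
    apply: (leq_trans (leq_bigmax i)).
    by apply: (@leq_bigmax_seq _ _ xpredT (fun m : {ffun 'I_r -> nat} => (\max_i m i)%N));
      rewrite ?in_fset_set ?inE.
  apply: (@le_trans _ _ (mzv_trunc N)%:E); last first.
    by apply: ereal_sup_ubound; exists N.
  rewrite -sum_S_; apply: lee_fsum_nneg_subset => //.
    move=> m; rewrite !inE => Am; apply/S_P; split; first exact: AS.
    by move=> i; exact: AN.
  by move=> m _; rewrite lee_fin; exact: a_ge0.
apply: ge_ereal_sup => _ [N _ <-] /=; apply: ereal_sup_ubound.
exists (S_ N); last exact: sum_S_.
by split=> // m /S_P[].
Qed.

Lemma mzv_trunc_ge0 N : 0 <= mzv_trunc N.
Proof.
by rewrite -lee_fin -sum_S_; apply: fsume_ge0 => m _; rewrite lee_fin; exact: a_ge0.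
Qed.

(** The truncations increase with [N], so in the extended reals they converge to their supremum,
    finite or not. *)
Lemma cvg_mzv_trunc : EFin \o mzv_trunc @ \oo --> mzv R alpha.
Proof.
rewrite mzvE; apply: ereal_nondecreasing_cvgn => M N MN /=.
rewrite -!sum_S_; apply: lee_fsum_nneg_subset => //.
  move=> m; rewrite !inE => /S_P[Sm mM]; apply/S_P; split=> // i.
  exact: leq_trans MN.
by move=> m _; rewrite lee_fin; exact: a_ge0.
Qed.

End truncated_mzv.

(** For fixed [m], distributing the product of the [geom_poly] gives one term per choice of positive
    exponents, and extracting t^n keeps the choices of total n. *)
Lemma sum_mzv_trunc (R : realType) (n k N : nat) :
  \sum_(alpha : {ffun 'I_k -> 'I_n.+1} |
      [forall i, (0 < alpha i)%N] && (\sum_(i < k) alpha i == n)%N)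
    mzv_trunc R (fun i => (2 * alpha i)%N) N =
  (esymf (geom_poly n (fun j => (j.+1%:R ^+ 2)^-1 : R)) N k)`_n.
Proof.
rewrite esymf_sum coef_sum exchange_big/=; apply: eq_bigr => m _.
pose x j : R := (j.+1%:R ^+ 2)^-1.
have pE j : geom_poly n x j = \sum_(a < n.+1 | (0 < a)%N) (x j ^+ a) *: 'X^a.
  rewrite /geom_poly big_add1/= big_mkord [RHS]big_mkcond big_ord_recl/= add0r.
  exact: eq_bigr.
under [in RHS]eq_bigr do rewrite pE.
rewrite bigA_distr_big coef_sum big_mkcondr/=; apply: eq_big => [alpha|alpha _].
  by apply/forallP/ffun_onP.
rewrite scaler_prod -(big_morph _ (exprD 'X) (expr0 'X)) coefZ coefXn eq_sym.
case: eqP => _; last by rewrite mulr0.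
rewrite [RHS]mulr1; apply: eq_bigr => i _.
by rewrite /x exprVn -exprM.
Qed.

Theorem theoremB (R : realType) (n k : nat) (hk : (1 <= k)%N) (hkn : (k <= n)%N) :
  even_mzv_sum R n k =
  ((-1) ^+ (n - k) * pi ^+ (2 * n) / (2 * n + 1)`!%:R *
   \sum_(0 <= q < (n - k).+1)
     'C(n - q, k)%:R * 'C(2 * n + 1, 2 * q)%:R * 2 ^+ (2 * q) *
     (bernoulli_poly R (2 * q)).[2^-1])%:E.
Proof.
set P := fun alpha : {ffun 'I_k -> 'I_n.+1} =>
  [forall i, (0 < alpha i)%N] && (\sum_(i < k) alpha i == n)%N.
have H1 : (fun N => \sum_(alpha | P alpha)
      (mzv_trunc R (fun i => (2 * alpha i)%N) N)%:E)%E @ \oo --> even_mzv_sum R n k.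
  (* Nonnegativity lets limits be added in the extended reals. *)
  apply: cvg_nnesum => alpha _; last exact: cvg_mzv_trunc.
  by apply: nearW => N; rewrite lee_fin mzv_trunc_ge0.
(* The other limit is a real number, so uniqueness also yields finiteness of the sum. *)
apply: (cvg_unique _ H1) => //.
have E : (fun N => \sum_(alpha | P alpha)
      (mzv_trunc R (fun i => (2 * alpha i)%N) N)%:E)%E =
    EFin \o (fun N => (esymf (geom_poly n (fun j => (j.+1%:R ^+ 2)^-1 : R)) N k)`_n).
  by apply/funext => N; rewrite sumEFin /= -sum_mzv_trunc.
rewrite E; apply: cvg_EFin; [exact: nearW|exact: cvg_esymf_geom].
Qed.
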